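(* Let $A \subseteq B$ be an inclusion of C*-algebras. If there exists an intermediate C*-algebra $A \subseteq C \subseteq B$ with Property (SP), then $A \subseteq B$ is an SP-inclusion. In particular, if either $A$ or $B$ has Property (SP), then $A \subseteq B$ is an SP-inclusion. Moreover, a C*-algebra $C$ has Property (SP) if and only if $C \subseteq C$ is an SP-inclusion.
   Context: A C*-algebra has Property (SP) if each of its nonzero hereditary C*-subalgebras contains a nonzero projection. An inclusion of C*-algebras $A \subseteq B$ is called an SP-inclusion if for every nonzero element $a \in A_+$ the hereditary C*-subalgebra $\overline{aBa}$ of $B$ contains a nonzero projection. *)

(* Defs.v *)
From HB Require Import structures.
From mathcomp Require Import all_boot all_order all_algebra.
From mathcomp Require Import all_classical all_reals all_analysis.
From mathcomp Require Export complex.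

Set Implicit Arguments.
Unset Strict Implicit.
Unset Printing Implicit Defensive.

Import Order.TTheory GRing.Theory Num.Theory numFieldNormedType.Exports.

Local Open Scope classical_set_scope.
Local Open Scope ring_scope.
Local Open Scope complex_scope.

(* MathComp's algebras have a unit, whereas a C*-algebra need not: the product
   is therefore added to a complex Banach space as a new operation.  The norm of
   a normedModType over R[i] takes its values in R[i]. *)
HB.mixin Record isCStarAlgebra (R : realType) A
    of CompleteNormedModule R[i] A := {
  cmul : A -> A -> A ;
  star : A -> A ;
  cmulA : associative cmul ;
  cmulDl : left_distributive cmul +%R ;
  cmulDr : right_distributive cmul +%R ;
  cmulZl : forall (k : R[i]) (x y : A), cmul (k *: x) y = k *: cmul x y ;
  cmulZr : forall (k : R[i]) (x y : A), cmul x (k *: y) = k *: cmul x y ;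
  ler_norm_cmul : forall x y : A, `|cmul x y| <= `|x| * `|y| ;
  starK : involutive star ;
  starD : {morph star : x y / x + y} ;
  starZ : forall (k : R[i]) (x : A), star (k *: x) = k^* *: star x ;
  starM : forall x y : A, star (cmul x y) = cmul (star y) (star x) ;
  norm_star_cmul : forall x : A, `|cmul (star x) x| = `|x| ^+ 2
}.

#[short(type="cstarAlgType")]
HB.structure Definition CStarAlgebra (R : realType) :=
  { A of isCStarAlgebra R A & CompleteNormedModule R[i] A }.

Declare Scope cstar_scope.
Delimit Scope cstar_scope with CS.
Notation "x ** y" := (cmul x y) (at level 40, left associativity) : cstar_scope.
Local Open Scope cstar_scope.

(* Every C*-algebra below is a C*-subalgebra of an ambient one E, so that
   inclusions are inclusions of sets; a C*-algebra in its own right is the case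
   of [set: E].  The positive cone, the order and the hereditary C*-subalgebras
   of D are the intrinsic ones: their witnesses are taken in D, not in E. *)
Section CStarSubalgebras.
Context {R : realType} {E : cstarAlgType R}.
Implicit Types (A B D H : set E) (a p x y : E).

Definition cstar_subalgebra D : Prop :=
  D 0 /\
  (forall x y, D x -> D y -> D (x + y)) /\
  (forall (k : R[i]) x, D x -> D (k *: x)) /\
  (forall x y, D x -> D y -> D (x ** y)) /\
  (forall x, D x -> D (star x)) /\
  closed D.

Lemma cstar_subalgebraT : cstar_subalgebra [set: E].
Proof. by do 5!split => //; exact: closedT. Qed.

Definition positive D : set E := [set star x ** x | x in D].

Definition cstar_le D x y : Prop := positive D (y - x).

Definition hereditary D H : Prop :=
  [/\ cstar_subalgebra H, H `<=` D &
      forall x y, positive D x -> positive H y -> cstar_le D x y -> H x].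

Definition projection p : Prop := star p = p /\ p ** p = p.

Definition has_nonzero_projection H : Prop :=
  exists p, [/\ H p, projection p & p != 0].

Definition property_SP D : Prop :=
  forall H, hereditary D H -> (exists2 x, H x & x != 0) ->
    has_nonzero_projection H.

Definition hereditary_gen D a : set E := closure [set a ** x ** a | x in D].

Definition SP_inclusion A B : Prop :=
  forall a, positive A a -> a != 0 ->
    has_nonzero_projection (hereditary_gen B a).

End CStarSubalgebras.

(* Main.v *)
Require Import Defs.
From HB Require Import structures.
From mathcomp Require Import all_boot all_order all_algebra.
From mathcomp Require Import all_classical all_reals all_analysis.
From mathcomp Require Import complex ring lra.

(** Everything reduces to the two implications relating the order-theoretic
    notion of hereditary subalgebra to the algebraic one.

    If [a] is a positive element of [C], then the closure of [a C a] is
    hereditary in [C] ([hereditary_hereditary_gen]).  Given [C] with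
    Property (SP) between [A] and [B] and a nonzero positive [a] in [A], this
    closure contains [a a a], which is not zero, so it contains a nonzero
    projection, and it lies in the closure of [a B a].  Conversely, if [H] is
    hereditary in [C] and [a] is positive in [H], then [H] contains the
    closure of [a C a] ([hereditary_gen_sub]).  If [C] in [C] is an
    SP-inclusion, a nonzero [x] in [H] therefore gives a nonzero projection of
    [H], by taking [a = x^* x].

    For the first implication let [0 <= x <= y] with [y] in the closure of
    [a C a].  With [f = (1 - a / t)^k] the product [y f] is small, because
    [a f] is ([approx_unit]); since [f x f <= f y f], the element [x f] is small
    as well, and [x] is close to [(1 - f) x (1 - f)], which lies in [a C a].
    For the second, write a self-adjoint [c] of norm at most [K] as
    [(K + c) - K]; then [0 <= a (K + c) a <= 2 K a a], hence [a c a] is in [H].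

    Both arguments rest on the theory of the positive cone, which is developed
    here in the unitization of the ambient algebra, from the axioms.  Square
    roots come from a fixed point iteration ([pos_sqrt]).  For self-adjoint
    [p], [q] that commute, [p + i q] is normal, and so
    [|p|^2 <= |p^2 + q^2|] ([norm_le_sqD_comm]); this replaces the functional
    calculus and yields that squares are positive ([pos_sq]) and that the norm
    is monotone on the cone ([pos_norm_le]).  The one deep fact is that
    [x^* x] is always positive ([pos_ustar_mul]), by Kaplansky's trick: were the
    negative part of [x^* x] nonzero, there would be [y] and a nonzero
    self-adjoint [q] with [y^* y = - q^2]; then [y y^*] is positive, whereas
    [y^* (1 - y y^* / t)^k y], which stays bounded, dominates a multiple of
    [k q^4] in norm ([ustar_mul_neg_square_eq0]). *)

Import Order.TTheory GRing.Theory Num.Theory numFieldNormedType.Exports.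

Local Open Scope classical_set_scope.
Local Open Scope ring_scope.
Local Open Scope complex_scope.
Local Open Scope cstar_scope.

Set Implicit Arguments.
Unset Strict Implicit.
Unset Printing Implicit Defensive.

(** * Unitization *)
Section CStarBasics.
Context {R : realType} {E : cstarAlgType R}.
Implicit Types x y : E.

Lemma mul0c x : 0 ** x = 0 :> E.
Proof. by apply: (addrI (0 ** x)); rewrite -cmulDl !addr0. Qed.

Lemma mulc0 x : x ** 0 = 0 :> E.
Proof. by apply: (addrI (x ** 0)); rewrite -cmulDr !addr0. Qed.

Lemma star0 : star (0 : E) = 0.
Proof. by apply: (addrI (star 0)); rewrite -starD !addr0. Qed.

Lemma norm_star x : `|star x| = `|x|.
Proof.
have le_star y : `|y| <= `|star y|.
  have [->|y0] := eqVneq y 0; first by rewrite normr0.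
  have py : 0 < `|y| by rewrite normr_gt0.
  by rewrite -(ler_pM2r py) -expr2 -norm_star_cmul; exact: ler_norm_cmul.
by apply/eqP; rewrite eq_le le_star andbT -{2}(starK x) le_star.
Qed.

End CStarBasics.

(** The scalar component is [R[i]^o], so that the product of modules provides
    the module structure. *)
Definition unitization (R : realType) (E : cstarAlgType R) : Type :=
  (R[i]^o * E)%type.

Section UnitizationAlgebra.
Context {R : realType} {E : cstarAlgType R}.
Local Notation U := (unitization E).

HB.instance Definition _ := GRing.Lmodule.copy U (R[i]^o * E)%type.

Implicit Types m n : U.

Definition unitz1 : U := (1, 0).
(** The pair [(k, x)] stands for [k + x]. *)
Definition unitz_mul m n : U :=
  (m.1 * n.1, m.1 *: n.2 + n.1 *: m.2 + m.2 ** n.2).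

Lemma unitz_mulA : associative unitz_mul.
Proof.
move=> [k x] [l y] [h z]; rewrite /unitz_mul /=; congr pair; first exact: mulrA.
rewrite !scalerDr !cmulDl !cmulDr !cmulZl !cmulZr !scalerA cmulA.
by rewrite [h * k]mulrC [h * l]mulrC !addrA [LHS](ACl (1*2*4*6*3*5*7)).
Qed.

Lemma unitz_mul1l : left_id unitz1 unitz_mul.
Proof. by move=> [k x]; rewrite /unitz_mul /= mul1r scale1r scaler0 mul0c !addr0. Qed.

Lemma unitz_mul1r : right_id unitz1 unitz_mul.
Proof.
by move=> [k x]; rewrite /unitz_mul /= mulr1 scale1r scaler0 mulc0 add0r addr0.
Qed.

Lemma unitz_mulDl : left_distributive unitz_mul +%R.
Proof.
move=> [k x] [l y] [h z]; rewrite /unitz_mul /=; congr pair => /=.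
  exact: mulrDl.
by rewrite scalerDl scalerDr cmulDl !addrA [LHS](ACl (1*3*5*2*4*6)).
Qed.

Lemma unitz_mulDr : right_distributive unitz_mul +%R.
Proof.
move=> [k x] [l y] [h z]; rewrite /unitz_mul /=; congr pair => /=.
  exact: mulrDr.
by rewrite scalerDl scalerDr cmulDr !addrA [LHS](ACl (1*3*5*2*4*6)).
Qed.

Lemma unitz1_neq0 : unitz1 != 0.
Proof. by apply/eqP => -[] /eqP; rewrite oner_eq0. Qed.

HB.instance Definition _ := GRing.Zmodule_isNzRing.Build U
  unitz_mulA unitz_mul1l unitz_mul1r unitz_mulDl unitz_mulDr unitz1_neq0.

Lemma unitz_scaleAl (k : R[i]) m n : k *: (m * n) = (k *: m) * n.
Proof.
case: m n => [l x] [h y]; congr pair => /=; first exact: mulrA.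
by rewrite /= !scalerDr cmulZl !scalerA [h * _]mulrC.
Qed.

HB.instance Definition _ := GRing.Lmodule_isLalgebra.Build R[i] U unitz_scaleAl.

Lemma unitz_scaleAr (k : R[i]) m n : k *: (m * n) = m * (k *: n).
Proof.
case: m n => [l x] [h y]; congr pair => /=; first exact: mulrCA.
by rewrite /= !scalerDr cmulZr !scalerA [l * k]mulrC.
Qed.

HB.instance Definition _ := GRing.Lalgebra_isAlgebra.Build R[i] U unitz_scaleAr.

(** [E] is an ideal of its unitization: this is left multiplication by [m]
    on [E], see [mulU_inU]. *)
Definition act m (y : E) : E := m.1 *: y + m.2 ** y.

Lemma actM m n y : act (m * n) y = act m (act n y).
Proof.
rewrite /act /= !scalerDr !cmulDl !cmulDr !cmulZl !cmulZr scalerA cmulA.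
by rewrite !addrA.
Qed.

Lemma actDl m n y : act (m + n) y = act m y + act n y.
Proof. by rewrite /act /= scalerDl cmulDl addrACA. Qed.

Lemma actZl (k : R[i]) m y : act (k *: m) y = k *: act m y.
Proof. by rewrite /act /= scalerDr cmulZl scalerA. Qed.

Lemma act1 y : act 1 y = y.
Proof. by rewrite /act /= scale1r mul0c addr0. Qed.

Definition inU (x : E) : U := (0, x).

Lemma inUD x y : inU (x + y) = inU x + inU y.
Proof. by congr pair; rewrite /= addr0. Qed.

Lemma inUZ (k : R[i]) x : inU (k *: x) = k *: inU x.
Proof. by congr pair; rewrite /= scaler0. Qed.

Lemma inUN x : inU (- x) = - inU x.
Proof. by rewrite -scaleN1r inUZ scaleN1r. Qed.

Lemma inUB x y : inU (x - y) = inU x - inU y.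
Proof. by rewrite inUD inUN. Qed.

Lemma inUM x y : inU (x ** y) = inU x * inU y.
Proof. by congr pair; rewrite /= ?mulr0 // !scale0r !add0r. Qed.

Lemma act_inU x y : act (inU x) y = x ** y.
Proof. by rewrite /act /= scale0r add0r. Qed.

Lemma mulU_inU m x : m * inU x = inU (act m x).
Proof. by congr pair; rewrite /= ?mulr0 // scale0r addr0. Qed.

Definition ustar m : U := ((m.1 : R[i])^*, star m.2).

Lemma ustarK : involutive ustar.
Proof. by move=> [k x]; rewrite /ustar /= conjcK starK. Qed.

Lemma ustarD : {morph ustar : m n / m + n}.
Proof. by move=> m n; congr pair; rewrite /= ?starD ?rmorphD. Qed.

Lemma ustarZ (k : R[i]) m : ustar (k *: m) = (k^*)%C *: ustar m.
Proof. by congr pair; rewrite /= ?starZ //; exact: rmorphM. Qed.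

Lemma ustarM m n : ustar (m * n) = ustar n * ustar m.
Proof.
congr pair; rewrite /= ?rmorphM 1?mulrC //=.
by rewrite !starD !starZ starM [X in X + _]addrC.
Qed.

Lemma ustar1 : ustar 1 = 1.
Proof.
change (ustar 1) with (((1 : R[i])^*, star (0 : E)) : U).
by rewrite conjc1 star0.
Qed.

Lemma ustar0 : ustar 0 = 0.
Proof.
change (ustar 0) with (((0 : R[i])^*, star (0 : E)) : U).
by rewrite conjc0 star0.
Qed.

Lemma ustarN : {morph ustar : m / - m}.
Proof. by move=> m; rewrite -scaleN1r ustarZ rmorphN1 scaleN1r. Qed.

Lemma ustarB : {morph ustar : m n / m - n}.
Proof. by move=> m n; rewrite ustarD ustarN. Qed.

Lemma ustar_inU x : ustar (inU x) = inU (star x).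
Proof. by congr pair; exact: conjc0. Qed.

(** Left multiplication by [ustar m] is the adjoint of left multiplication by
    [m] for the [E]-valued inner product [star x ** y]. *)
Lemma star_act m x y : star (act m x) ** y = star x ** act (ustar m) y.
Proof.
have /(congr1 snd) : ustar (m * inU x) * inU y = ustar (inU x) * (ustar m * inU y).
  by rewrite ustarM mulrA.
by rewrite !mulU_inU !ustar_inU /= !act_inU.
Qed.

End UnitizationAlgebra.

(** * Operator norm bounds *)
Section OperatorBounds.
Context {R : realType} {E : cstarAlgType R}.
Local Notation U := (unitization E).
Implicit Types (m n : U) (K L e : R[i]) (x y : E).

(** The C*-norm of [m] is the maximum of the modulus of its scalar part and of
    the norm of [m] as a left multiplier of [E]; only upper bounds of it are
    needed.  The scalar part is included because when [E] already has a unit,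
    the multiplier norm alone is merely a seminorm on the unitization. *)
Definition norm_le m K : Prop :=
  `|m.1 : R[i]| <= K /\ forall y, `|act m y| <= K * `|y|.

Lemma norm_le_ge0 m K : norm_le m K -> 0 <= K.
Proof. by case=> /(le_trans _) + _; apply. Qed.

Lemma norm_le_trans m K L : K <= L -> norm_le m K -> norm_le m L.
Proof.
move=> KL [m1 m2]; split; first exact: le_trans KL.
by move=> y; apply: le_trans (m2 y) _; exact: ler_wpM2r.
Qed.

Lemma norm_le1 : norm_le 1 1.
Proof. by split=> [|y]; [rewrite normr1 | rewrite act1 mul1r]. Qed.

Lemma norm_leD m n K L : norm_le m K -> norm_le n L -> norm_le (m + n) (K + L).
Proof.
move=> [m1 m2] [n1 n2]; split; first exact: le_trans (ler_normD _ _) (lerD _ _).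
move=> y; rewrite actDl mulrDl.
by apply: le_trans (ler_normD _ _) (lerD _ _).
Qed.

Lemma norm_leZ (k : R[i]) m K : norm_le m K -> norm_le (k *: m) (`|k| * K).
Proof.
move=> [m1 m2]; split; first by rewrite normrM ler_wpM2l.
by move=> y; rewrite actZl normrZ -mulrA ler_wpM2l.
Qed.

Lemma norm_le0 : norm_le 0 0.
Proof. by have := norm_leZ 0 norm_le1; rewrite scale0r normr0 mul0r. Qed.

Lemma norm_leN m K : norm_le m K -> norm_le (- m) K.
Proof. by move=> /(norm_leZ (-1)); rewrite scaleN1r normrN1 mul1r. Qed.

Lemma norm_leB m n K L : norm_le m K -> norm_le n L -> norm_le (m - n) (K + L).
Proof. by move=> mK /norm_leN; exact: norm_leD. Qed.

Lemma norm_leM m n K L : norm_le m K -> norm_le n L -> norm_le (m * n) (K * L).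
Proof.
move=> mK; have K0 := norm_le_ge0 mK; case: mK => m1 m2 [n1 n2]; split.
  by rewrite normrM ler_pM.
by move=> y; rewrite actM -mulrA; apply: le_trans (m2 _) _; exact: ler_wpM2l.
Qed.

Lemma norm_leX m K i : norm_le m K -> norm_le (m ^+ i) (K ^+ i).
Proof.
move=> mK; elim: i => [|i IHi]; first by rewrite !expr0; exact: norm_le1.
by rewrite !exprS; exact: norm_leM.
Qed.

(** The C*-identity for the unitization: the one of [E], applied to
    [act m y], turns [|m y|^2] into [|y^* (m^* m y)|]. *)
Lemma norm_le_of_sq m K : 0 <= K -> norm_le (ustar m * m) (K ^+ 2) -> norm_le m K.
Proof.
move=> K0 [m1 m2]; split.
  rewrite -(@ler_pXn2r _ 2) ?nnegrE // -normrX.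
  suff <- : `|(ustar m * m).1| = `|m.1 ^+ 2| by [].
  by rewrite /= normrM normcJ normrX -expr2.
move=> y; rewrite -(@ler_pXn2r _ 2) ?nnegrE ?mulr_ge0 //.
rewrite -norm_star_cmul star_act -actM.
apply: le_trans (ler_norm_cmul _ _) _; rewrite norm_star exprMn mulrC expr2.
by rewrite (expr2 `|y|) mulrA ler_wpM2r.
Qed.

(** [|m^* y|^2 = |y^* (m m^* y)| <= |y| K |m^* y|], then divide. *)
Lemma norm_le_ustar m K : norm_le m K -> norm_le (ustar m) K.
Proof.
move=> mK; have K0 := norm_le_ge0 mK; case: mK => m1 m2; split.
  by rewrite /= normcJ.
move=> y; have [->|/eqP ny0] := eqVneq (`|act (ustar m) y|) 0.
  by rewrite mulr_ge0.
have py : 0 < `|act (ustar m) y| by rewrite lt_def normr_ge0 andbT; apply/eqP.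
rewrite -(ler_pM2r py) -expr2 -norm_star_cmul star_act ustarK.
apply: le_trans (ler_norm_cmul _ _) _; rewrite norm_star.
by rewrite -mulrA mulrCA ler_wpM2l.
Qed.

Lemma norm_le_sq m K : norm_le m K -> norm_le (ustar m * m) (K ^+ 2).
Proof. by move=> mK; rewrite expr2; apply: norm_leM => //; exact: norm_le_ustar. Qed.

Lemma norm_le_inU x : norm_le (inU x) `|x|.
Proof. by split=> [|y]; [rewrite normr0 | rewrite act_inU ler_norm_cmul]. Qed.

Lemma norm_le_sum m : norm_le m (`|m.1 : R[i]| + `|m.2|).
Proof.
have -> : m = m.1 *: (1 : U) + inU m.2.
  rewrite [LHS]surjective_pairing; congr pair; rewrite /= ?addr0 ?scaler0 ?add0r //.
  by rewrite [RHS]mulr1.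
have -> : (m.1 *: (1 : U) + inU m.2).1 = m.1.
  by rewrite /= addr0 [LHS]mulr1.
have -> : (m.1 *: (1 : U) + inU m.2).2 = m.2 by rewrite /= scaler0 add0r.
apply: norm_leD (norm_le_inU _); rewrite -[X in norm_le _ X]mulr1.
exact: norm_leZ norm_le1.
Qed.

(** The bound is attained on [star x], so [E] embeds isometrically. *)
Lemma norm_le_inU_inv x K : norm_le (inU x) K -> `|x| <= K.
Proof.
move=> xK; have K0 := norm_le_ge0 xK; case: xK => _ /(_ (star x)).
have [->|x0] := eqVneq x 0; first by rewrite normr0.
rewrite act_inU -{1}(starK x) norm_star_cmul norm_star expr2.
by rewrite ler_pM2r ?normr_gt0.
Qed.

Lemma norm_le_snd m K : norm_le m K -> `|m.2| <= K *+ 2.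
Proof.
move=> mK; apply: norm_le_inU_inv.
have -> : inU m.2 = m - m.1 *: (1 : U).
  rewrite [X in _ = X - _]surjective_pairing.
  congr pair; rewrite /= ?scaler0 ?subr0 //.
  by rewrite [X in _ - X]mulr1 subrr.
rewrite mulr2n; apply: norm_leB => //.
apply: norm_le_trans (norm_leZ _ norm_le1); rewrite mulr1; by case: mK.
Qed.

Lemma norm_le_eps m K : (forall e, 0 < e -> norm_le m (K + e)) -> norm_le m K.
Proof.
move=> mK; have eps (a b : R[i]) : 0 <= b ->
    (forall e, 0 < e -> a <= (K + e) * b) -> a <= K * b.
  move=> b0 ab; apply/ler_addgt0Pr => e e0.
  have b1 : 0 < b + 1 by rewrite ltr_wpDl.
  apply: le_trans (ab (e / (b + 1)) _) _; first exact: divr_gt0.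
  rewrite mulrDl lerD2l mulrAC ler_pdivrMr // ler_pM2l //.
  by rewrite lerDl.
split=> [|y].
  by rewrite -[K]mulr1; apply: eps => // e /mK[]; rewrite mulr1.
by apply: eps => // e /mK[].
Qed.

Lemma norm_le_eq0 m : norm_le m 0 -> m = 0.
Proof.
move=> m0; have := norm_le_snd m0; rewrite mul0rn normr_le0 => /eqP m2.
case: m0; rewrite normr_le0 => /eqP m1 _.
by rewrite [m]surjective_pairing m1 m2.
Qed.

(** Sets containing every element that they approximate in norm; this form
    needs no topology on the unitization. *)
Definition norm_closed (S : set U) : Prop :=
  forall m, (forall e, 0 < e -> exists2 n, S n & norm_le (m - n) e) -> S m.

End OperatorBounds.

Lemma cauchy_norm_lim (K : numFieldType) (V : completeNormedModType K)
    (u : nat -> V) :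
  (forall e : K, 0 < e -> exists N, forall n, (N <= n)%N -> `|u N - u n| < e) ->
  exists l, forall e : K, 0 < e ->
    exists N, forall n, (N <= n)%N -> `|l - u n| < e.
Proof.
move=> cu; have /cauchy_cvg uc : cauchy (u @ \oo).
  apply: cauchy_exP => e e0; have [N uN] := cu e e0.
  exists (u N); exists N => // n /= Nn.
  by rewrite -ball_normE; exact: uN.
exists (lim (u @ \oo)) => e e0.
by have /cvgrPdist_lt /(_ e e0) [N _ uN] := uc; exists N.
Qed.

Section Completeness.
Context {R : realType}.

(** Only real tolerances matter, as the positive elements of [R[i]] are real;
    the limit is taken on the real and imaginary parts. *)
Lemma cauchy_complex_lim (u : nat -> R[i]) :
  (forall e : R, 0 < e ->
     exists N, forall n, (N <= n)%N -> `|u N - u n| < e%:C) ->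
  exists l, forall e : R, 0 < e ->
    exists N, forall n, (N <= n)%N -> `|l - u n| < e%:C.
Proof.
move=> cu.
have lim_of (g : {additive R[i] -> R}) : (forall z, `|g z|%:C <= `|z|) ->
    exists l, forall e : R, 0 < e ->
      exists N, forall n, (N <= n)%N -> `|l - g (u n)| < e.
  move=> gz; apply: (@cauchy_norm_lim R R^o (g \o u)) => e e0.
  have [N uN] := cu e e0; exists N => n /uN; rewrite -ltcR.
  by rewrite /= -raddfB; apply: le_lt_trans (gz _).
have [a ua] : exists l, forall e : R, 0 < e ->
    exists N, forall n, (N <= n)%N -> `|l - complex.Re (u n)| < e.
  exact: (lim_of _ (@normc_ge_Re R)).
have [b ub] : exists l, forall e : R, 0 < e ->
    exists N, forall n, (N <= n)%N -> `|l - complex.Im (u n)| < e.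
  apply: (lim_of _) => z /=.
  have -> : complex.Im z = complex.Re (- 'i * z).
    by case: z => x y /=; rewrite !(mul0r, mulN1r, oppr0, sub0r, opprK).
  rewrite (le_trans (normc_ge_Re _)) // normrM normrN.
  suff -> : `|'i : R[i]| = 1 by rewrite mul1r.
  by rewrite normc_def /= expr0n add0r expr1n sqrtr1.
exists (a +i* b) => e e0.
have e2 : 0 < e / 2 by rewrite divr_gt0.
have [N1 uN1] := ua _ e2; have [N2 uN2] := ub _ e2.
exists (maxn N1 N2) => n; rewrite geq_max => /andP[/uN1 n1 /uN2 n2].
have -> : a +i* b - u n =
    (a - complex.Re (u n))%:C + 'i * (b - complex.Im (u n))%:C.
  by case: (u n) => x y; apply/eqP; rewrite eq_complex /=;
    rewrite !(mul0r, mul1r, mulr0, addr0, add0r, subr0) !eqxx.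
apply: le_lt_trans (ler_normD _ _) _; rewrite normrM.
have -> : `|'i : R[i]| = 1 by rewrite normc_def /= expr0n add0r expr1n sqrtr1.
have -> : e%:C = (e / 2)%:C + (e / 2)%:C :> R[i] by rewrite -rmorphD -splitr.
by rewrite mul1r; apply: ltrD;
  rewrite normc_def /= expr0n addr0 sqrtr_sqr ltcR.
Qed.

End Completeness.

Section UnitizationComplete.
Context {R : realType} {E : cstarAlgType R}.
Local Notation U := (unitization E).

(** A sequence dominated by a bounded monotone real sequence is Cauchy in each
    component, and [E] and [R[i]] are complete. *)
Lemma unitz_complete (f : nat -> U) (phi : nat -> R) :
  {homo phi : n m / (n <= m)%N >-> n <= m} -> (forall n, phi n <= 1) ->
  (forall n m, (n <= m)%N -> norm_le (f m - f n) (phi m - phi n)%:C) ->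
  exists l, forall e : R[i], 0 < e ->
    exists N, forall n, (N <= n)%N -> norm_le (l - f n) e.
Proof.
move=> homo_phi phi1 fphi.
have cphi (e : R) : 0 < e ->
    exists N, forall n, (N <= n)%N -> phi n - phi N < e.
  move=> e0; have ub : has_ubound (range phi) by exists 1 => _ [n _ <-].
  have := nondecreasing_is_cvgn homo_phi ub.
  move/cvgrPdist_lt => /(_ (e / 2) (divr_gt0 e0 (ltr0Sn _ _)))[N _ pN].
  exists N => n Nn; rewrite [e]splitr.
  have := pN n Nn; have := pN N (leqnn N); rewrite !ltr_norml.
  move=> /andP[_ +] /andP[+ _]; move=> h1 h2.
  have := ltrD h1 h2; lra.
have [l1 fl1] : exists l : R[i], forall e : R, 0 < e ->
    exists N, forall n, (N <= n)%N -> `|l - (f n).1| < e%:C.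
  apply: cauchy_complex_lim => e /cphi[N pN]; exists N => n Nn.
  rewrite distrC; have [+ _] := fphi _ _ Nn => /le_lt_trans; apply.
  by rewrite ltcR pN.
have gt0C (e : R[i]) : 0 < e -> exists2 r : R, 0 < r & e = r%:C.
  by case: e => a b; rewrite ltcE /= => /andP[/eqP -> a0]; exists a.
have [l2 fl2] : exists l : E, forall e : R[i], 0 < e ->
    exists N, forall n, (N <= n)%N -> `|l - (f n).2| < e.
  apply: cauchy_norm_lim => e /gt0C[r r0 ->].
  have /cphi[N pN] : 0 < r / 2 by rewrite divr_gt0.
  exists N => n Nn; rewrite distrC.
  apply: le_lt_trans (norm_le_snd (fphi _ _ Nn)) _.
  rewrite -mulr_natr -(rmorph_nat (@real_complex R)) -rmorphM ltcR.
  by rewrite -ltr_pdivlMr // pN.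
exists (l1, l2) => e /gt0C[r r0 ->].
have r2 : 0 < r / 2 by rewrite divr_gt0.
have [N1 fN1] := fl1 _ r2; have [|N2 fN2] := fl2 (r / 2)%:C.
  by rewrite ltcR.
exists (maxn N1 N2) => n; rewrite geq_max => /andP[/fN1 n1 /fN2 n2].
apply: norm_le_trans (norm_le_sum _).
have -> : r%:C = (r / 2)%:C + (r / 2)%:C :> R[i] by rewrite -rmorphD -splitr.
by apply: lerD; exact: ltW.
Qed.

End UnitizationComplete.

(** * Square roots *)
Section SquareRoot.
Context {R : realType} {E : cstarAlgType R}.
Local Notation U := (unitization E).
Implicit Types (m n z p q : U) (K L e t : R[i]) (x y : E).

(** Iteration for [l = (s + l^2) / 2], whose solution satisfies
    [(1 - l)^2 = 1 - s]. *)
Fixpoint sqrt_seq (A : algType R[i]) (s : A) (i : nat) : A :=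
  if i is j.+1 then 2^-1 *: (s + sqrt_seq s j * sqrt_seq s j) else 0.

(** The same iteration for [s = 1] in the reals: it increases and stays below
    [1], and it dominates [sqrt_seq s] whenever [s] has norm at most [1].  The
    case of norm exactly [1] is included, so that no perturbation is needed to
    extract square roots of elements that are not invertible. *)
Fixpoint sqrt_dom (i : nat) : R :=
  if i is j.+1 then 2^-1 * (1 + sqrt_dom j * sqrt_dom j) else 0.

Lemma sqrt_dom01 i : 0 <= sqrt_dom i <= 1.
Proof. by elim: i => [|i /andP[h0 h1]] /=; [rewrite lexx ler01 | nra]. Qed.

Lemma sqrt_dom_homo : {homo sqrt_dom : i j / (i <= j)%N >-> i <= j}.
Proof.
apply: homo_leq => [//|y x z|i]; first exact: le_trans.
have /andP[_ h1] := sqrt_dom01 i; rewrite /=; nra.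
Qed.

Lemma norm_le_half m K : norm_le m K -> norm_le (2^-1 *: m) (2^-1 * K).
Proof. by move=> /(norm_leZ 2^-1); rewrite ger0_norm. Qed.

Lemma norm_le_sqrt_seq m i : norm_le m 1 -> norm_le (sqrt_seq m i) (sqrt_dom i)%:C.
Proof.
move=> m1; elim: i => [|i IHi]; first exact: norm_le0.
rewrite /= rmorphM rmorphD rmorphM fmorphV rmorph_nat rmorph1.
by apply: norm_le_half; apply: norm_leD => //; exact: norm_leM.
Qed.

Lemma sqrt_stepB (A : algType R[i]) (r f g : A) :
  2^-1 *: (r + f * f) - 2^-1 *: (r + g * g) =
  2^-1 *: ((f - g) * f + g * (f - g)).
Proof.
rewrite -scalerBr [in LHS]opprD addrACA subrr add0r mulrBl mulrBr.
by rewrite addrA subrK.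
Qed.

Lemma norm_le_sqrt_seqB m i j : norm_le m 1 -> (i <= j)%N ->
  norm_le (sqrt_seq m j - sqrt_seq m i) (sqrt_dom j - sqrt_dom i)%:C.
Proof.
move=> m1 /subnK <-; elim: (j - i)%N => [|k IHk].
  by rewrite add0n !subrr; exact: norm_le0.
rewrite addSn; set l := (k + i)%N in IHk *.
have -> : sqrt_seq m l.+1 - sqrt_seq m i =
    sqrt_seq m l.+1 - sqrt_seq m l + (sqrt_seq m l - sqrt_seq m i).
  by rewrite addrA subrK.
have -> : (sqrt_dom l.+1 - sqrt_dom i)%:C =
    (sqrt_dom l.+1 - sqrt_dom l)%:C + (sqrt_dom l - sqrt_dom i)%:C :> R[i].
  by rewrite -rmorphD /= addrA subrK.
apply: norm_leD => //; elim: l {IHk} => [|l IHl].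
  change (norm_le (sqrt_seq m 1 - 0) (sqrt_dom 1 - 0)%:C); rewrite !subr0.
  exact: norm_le_sqrt_seq.
rewrite sqrt_stepB.
have -> : (sqrt_dom l.+2 - sqrt_dom l.+1)%:C =
    2^-1 * ((sqrt_dom l.+1 - sqrt_dom l)%:C * (sqrt_dom l.+1)%:C +
            (sqrt_dom l)%:C * (sqrt_dom l.+1 - sqrt_dom l)%:C) :> R[i].
  rewrite -!rmorphM -rmorphD -(rmorph_nat (@real_complex R)) -fmorphV -rmorphM.
  by congr (_%:C); rewrite /=; ring.
apply: norm_le_half.
by apply: norm_leD; [apply: norm_leM (norm_le_sqrt_seq l.+1 m1)
                    |apply: norm_leM (norm_le_sqrt_seq l m1) _].
Qed.

Lemma norm_closed_norm_le K : norm_closed [set m : U | norm_le m K].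
Proof.
move=> m mK; apply: norm_le_eps => e /mK[n nK mn].
by rewrite -(subrK n m) addrC; exact: norm_leD.
Qed.

Lemma norm_closed_ustar : norm_closed [set m : U | ustar m = m].
Proof.
move=> m am; apply/subr0_eq/norm_le_eq0/norm_le_eps => e e0; rewrite add0r.
have [|n /= an mn] := am (e / 2); first by rewrite divr_gt0.
have -> : ustar m - m = ustar (m - n) - (m - n).
  by rewrite ustarB an opprB addrA subrK.
by rewrite [e]splitr; apply: norm_leB => //; exact: norm_le_ustar.
Qed.

Lemma norm_closed_comm z : norm_closed [set m : U | GRing.comm z m].
Proof.
move=> m zm; apply/subr0_eq/norm_le_eq0/norm_le_eps => e e0; rewrite add0r.
pose L := `|z.1 : R[i]| + `|z.2|; have zL : norm_le z L := norm_le_sum z.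
have L1 : 0 < L *+ 2 + 1 by rewrite ltr_wpDl // mulrn_wge0 // (norm_le_ge0 zL).
have [|n /= zn mn] := zm (e / (L *+ 2 + 1)); first exact: divr_gt0.
have -> : z * m - m * z = z * (m - n) - (m - n) * z.
  by rewrite mulrBr mulrBl zn opprB addrA subrK.
apply: norm_le_trans (norm_leB (norm_leM zL mn) (norm_leM mn zL)).
rewrite [_ * L]mulrC -mulr2n -mulrnAl mulrCA.
by apply: ler_piMr; [exact: ltW | rewrite ler_pdivrMr // mul1r lerDl].
Qed.

Lemma norm_closed_snd (D : set E) : closed D -> norm_closed [set m : U | D m.2].
Proof.
move=> cD m mD; apply: cD => B /nbhs_ballP[e /= e0 eB].
have [|n /= nD mn] := mD (e / 3); first by rewrite divr_gt0.
exists n.2; split => //; apply: eB; rewrite -ball_normE /=.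
apply: le_lt_trans (norm_le_snd mn) _.
have -> : e / 3 *+ 2 = e * (2 / 3) by field.
by rewrite gtr_pMr // ltr_pdivrMr // mul1r ltr_nat.
Qed.

(** The second part is an induction principle: the properties of the root, such
    as self-adjointness or membership in a subalgebra, are those that the
    iteration preserves and that pass to norm limits. *)
Lemma sqrt_exists m : norm_le (1 - m) 1 ->
  exists2 p, p * p = m & forall S : set U, norm_closed S -> S 0 ->
    (forall f, S f -> S (2^-1 *: (1 - m + f * f))) -> S (1 - p).
Proof.
move=> m1; pose f := sqrt_seq (1 - m).
have [l fl] : exists l : U, forall e : R[i], 0 < e ->
    exists N, forall i : nat, (N <= i)%N -> norm_le (l - f i) e.
  apply: (unitz_complete sqrt_dom_homo) => [i|i j ij].
    by case/andP: (sqrt_dom01 i).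
  exact: norm_le_sqrt_seqB.
have Sl (S : set U) : norm_closed S -> S 0 ->
    (forall g, S g -> S (2^-1 *: (1 - m + g * g))) -> S l.
  move=> cS S0 Sf; apply: cS => e /fl[N /(_ N (leqnn N)) lN].
  by exists (f N) => //; elim: N {lN} => [|N IHN] //=; exact: Sf.
exists (1 - l); last by rewrite subKr.
have l1 : norm_le l 1.
  apply: (Sl [set m | norm_le m 1]); first exact: norm_closed_norm_le.
    by apply: norm_le_trans norm_le0; exact: ler01.
  move=> g g1; rewrite /= [X in norm_le _ X](_ : _ = 2^-1 * (1 + 1 * 1)).
    by apply: norm_le_half; apply: norm_leD => //; exact: norm_leM.
  by rewrite mulr1 mulVf // pnatr_eq0.
have fl1 i : norm_le (f i) 1.
  apply: norm_le_trans (norm_le_sqrt_seq i m1); rewrite -(rmorph1 (@real_complex R)) lecR.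
  by case/andP: (sqrt_dom01 i).
have fixl : 2^-1 *: (1 - m + l * l) = l.
  apply/subr0_eq/norm_le_eq0/norm_le_eps => e e0; rewrite add0r.
  have [N lN] := fl (e / 2) (divr_gt0 e0 (ltr0Sn _ _)).
  have := lN _ (leqnSn N); have {lN} := lN _ (leqnn N).
  move=> lN lN1.
  have -> : 2^-1 *: (1 - m + l * l) - l =
      2^-1 *: ((l - f N) * l + f N * (l - f N)) - (l - f N.+1).
    by rewrite -(sqrt_stepB (1 - m)) opprB addrA subrK.
  rewrite [e]splitr; apply: norm_leB => //.
  have -> : e / 2 = 2^-1 * (e / 2 * 1 + 1 * (e / 2)) by field.
  by apply: norm_le_half; apply: norm_leD; apply: norm_leM.
have half2 : 2^-1 + 2^-1 = 1 :> R[i] by rewrite [RHS]splitr !mul1r.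
have lE : 1 - m = l + l - l * l.
  by rewrite -[X in X + X - _]fixl -scalerDl half2 scale1r addrK.
rewrite mulrBl mul1r mulrBr mulr1 -[RHS](subKr 1) lE.
by rewrite !opprD !opprK !addrA.
Qed.

End SquareRoot.

(** * The positive cone of the unitization *)
Section Positivity.
Context {R : realType} {E : cstarAlgType R}.
Local Notation U := (unitization E).
Implicit Types (m n z p q : U) (K L e t : R[i]) (x y : E).

(** For self-adjoint [m] this says that the spectrum lies in [[0, 2 t]]; in
    this form it is evident that the cone is stable under sums. *)
Definition posU m : Prop :=
  ustar m = m /\ exists2 t : R[i], 0 < t & norm_le (t%:A - m) t.

Lemma conjc_ge0 K : 0 <= K -> (K^*)%C = K.
Proof. by case: K => a b; rewrite lecE /= => /andP[/eqP -> _]; rewrite oppr0. Qed.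

Lemma ustarZ_ge0 K m : 0 <= K -> ustar (K *: m) = K *: ustar m.
Proof. by move=> K0; rewrite ustarZ conjc_ge0. Qed.

Lemma ustarA K : 0 <= K -> ustar K%:A = K%:A :> U.
Proof. by move=> K0; rewrite ustarZ_ge0 // ustar1. Qed.

Lemma norm_leA K : 0 <= K -> norm_le (K%:A : U) K.
Proof. by move=> K0; have := norm_leZ K (@norm_le1 R E); rewrite mulr1 ger0_norm. Qed.

Lemma norm_leZ_ge0 K m L : 0 <= K -> norm_le m L -> norm_le (K *: m) (K * L).
Proof. by move=> K0 /(norm_leZ K); rewrite ger0_norm. Qed.

Lemma posD m n : posU m -> posU n -> posU (m + n).
Proof.
move=> [am [s s0 ms]] [an [t t0 nt]]; split; first by rewrite ustarD am an.
exists (s + t); first exact: addr_gt0.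
by rewrite scalerDl opprD addrACA; exact: norm_leD.
Qed.

Lemma posZ K m : 0 < K -> posU m -> posU (K *: m).
Proof.
move=> K0 [am [t t0 mt]]; split; first by rewrite ustarZ_ge0 ?am // ltW.
exists (K * t); first exact: mulr_gt0.
by rewrite -scalerA -scalerBr; apply: norm_leZ_ge0 => //; exact: ltW.
Qed.

Lemma pos_subA m t : ustar m = m -> 0 < t -> norm_le m t -> posU (t%:A - m).
Proof.
move=> am t0 mt; split; first by rewrite ustarB am ustarA // ltW.
by exists t => //; rewrite subKr.
Qed.

(** The last two properties say that the root lies in the bicommutant of [m],
    so that roots of commuting elements commute, and in the unitization of
    every subalgebra containing the [E]-component of [m]. *)
Lemma pos_sqrt m : posU m -> exists p,
  [/\ p * p = m, posU p, forall z, GRing.comm z m -> GRing.comm z p &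
      forall D : set E, cstar_subalgebra D -> D m.2 -> D p.2].
Proof.
move=> [am [t t0 mt]]; have t0' := ltW t0.
have tn0 : t != 0 by rewrite gt_eqF.
pose n := t^-1 *: m.
have n1 : norm_le (1 - n) 1.
  have -> : 1 - n = t^-1 *: (t%:A - m).
    by rewrite scalerBr scalerA mulVf // scale1r.
  rewrite -[X in norm_le _ X](mulVf tn0); apply: norm_leZ_ge0 => //.
  by rewrite invr_ge0.
have [q qq qS] := sqrt_exists n1.
have an : ustar n = n by rewrite ustarZ_ge0 ?am // invr_ge0.
have aq : ustar q = q.
  have : ustar (1 - q) = 1 - q.
    apply: (qS [set m | ustar m = m]); first exact: norm_closed_ustar.
      exact: ustar0.
    move=> f /= af; rewrite ustarZ_ge0 ?invr_ge0 // ustarD ustarM ustarB ustar1 an.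
    by rewrite af.
  by rewrite ustarB ustar1 => /addrI /oppr_inj.
have q1 : norm_le (1 - q) 1.
  apply: (qS [set m | norm_le m 1]); first exact: norm_closed_norm_le.
    by apply: norm_le_trans (@norm_le0 R E); exact: ler01.
  move=> f f1; rewrite /= [X in norm_le _ X](_ : _ = 2^-1 * (1 + 1 * 1)).
    by apply: norm_le_half; apply: norm_leD => //; exact: norm_leM.
  by rewrite mulr1 mulVf // pnatr_eq0.
have rt0 : 0 < sqrtC t by rewrite sqrtC_gt0.
exists (sqrtC t *: q); split.
- rewrite -scalerAl -scalerAr scalerA qq -expr2 sqrtCK scalerA.
  by rewrite mulfV // scale1r.
- apply: posZ => //; split => //.
  by exists 1; rewrite ?ltr01 // scale1r.
- move=> z zm; have zq : GRing.comm z (1 - q).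
    apply: (qS [set m | GRing.comm z m]); first exact: norm_closed_comm.
      exact: commr0.
    move=> f /= zf; rewrite /GRing.comm -scalerAl -scalerAr; congr (_ *: _).
    apply: commrD; last exact: commrM.
    apply: commrB; first exact: commr1.
    by rewrite /GRing.comm -scalerAl -scalerAr zm.
  have {}zq : GRing.comm z q.
    by rewrite -[q](subKr 1); apply: commrB => //; exact: commr1.
  by rewrite /GRing.comm -scalerAl -scalerAr zq.
move=> D [D0 [DD [DZ [DM [_ cD]]]]] Dm.
have DN x : D x -> D (- x) by move=> Dx; rewrite -scaleN1r; exact: DZ.
have : D (1 - q).2.
  apply: (qS [set m | D m.2]); first exact: norm_closed_snd.
    exact: D0.
  move=> f /= Df; apply: (DZ); apply: (DD); last first.
    by apply: (DD); [apply: (DD); exact: DZ | exact: DM].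
  by apply: (DD) => //; apply: (DN); exact: DZ.
by rewrite /= add0r => /DN; rewrite opprK => Dq; exact: DZ.
Qed.

(** [n = p + i q] is normal, [n^* n = p^2 + q^2], and [p] is the mean of [n]
    and [n^*]. *)
Lemma norm_le_sqD_comm p q K : ustar p = p -> ustar q = q -> GRing.comm p q ->
  0 <= K -> norm_le (p * p + q * q) (K ^+ 2) -> norm_le p K.
Proof.
move=> ap aq pq K0 pqK; pose n := p + 'i%C *: q.
have an : ustar n = p - 'i%C *: q.
  rewrite ustarD ustarZ ap aq -scaleNr; congr (_ + _ *: _).
  by apply/eqP; rewrite eq_complex /= oppr0 !eqxx.
have nK : norm_le n K.
  apply: norm_le_of_sq => //; rewrite an mulrBl !mulrDr.
  rewrite -!scalerAr -!scalerAl pq scalerA -['i%C * _]expr2 sqr_i scaleN1r.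
  by rewrite opprD opprK addrA addrK.
have -> : p = 2^-1 *: (n + ustar n).
  rewrite an addrACA subrr addr0 -mulr2n -[p *+ 2]scaler_nat scalerA.
  by rewrite mulVf ?scale1r // pnatr_eq0.
have -> : K = 2^-1 * (K + K) by field.
by apply: norm_le_half; apply: norm_leD => //; exact: norm_le_ustar.
Qed.

(** Scale to [r] of norm at most [1]; then [1 - r^2 = q^2] for a [q] commuting
    with [r], and [r^2 + q^2 = 1] bounds [q], hence [1 - r^2], by [1]. *)
Lemma pos_sq p : ustar p = p -> posU (p * p).
Proof.
move=> ap; split; first by rewrite ustarM ap.
pose K := `|p.1 : R[i]| + `|p.2| + 1.
have K0 : 0 < K by rewrite ltr_wpDl ?addr_ge0.
have pK : norm_le p K by apply: norm_le_trans (norm_le_sum p); rewrite lerDl.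
pose r := K^-1 *: p.
have ar : ustar r = r by rewrite ustarZ_ge0 ?ap // invr_ge0 ltW.
have r1 : norm_le r 1.
  rewrite -[X in norm_le _ X](@mulVf _ K) ?gt_eqF //.
  by apply: norm_leZ_ge0 => //; rewrite invr_ge0 ltW.
have [q [qq [aq _] qr _]] : exists q, [/\ q * q = 1 - r * r, posU q,
    forall z, GRing.comm z (1 - r * r) -> GRing.comm z q &
    forall D : set E, cstar_subalgebra D -> D (1 - r * r).2 -> D q.2].
  apply: pos_sqrt; split; first by rewrite ustarB ustar1 ustarM ar.
  exists 1; first exact: ltr01.
  by rewrite scale1r subKr -[X in norm_le _ X]mulr1; exact: norm_leM.
have q1 : norm_le q 1.
  apply: (@norm_le_sqD_comm _ r) => //.
    apply/commr_sym/qr; apply: commrB; first exact: commr1.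
    by apply: commrM.
  by rewrite qq subrK expr1n; exact: norm_le1.
exists (K ^+ 2); first exact: exprn_gt0.
have -> : (K ^+ 2)%:A - p * p = K ^+ 2 *: (q * q).
  rewrite qq scalerBr; congr (_ - _).
  rewrite /r -scalerAr -scalerAl !scalerA expr2.
  by rewrite mulfK ?gt_eqF // mulfV ?scale1r // gt_eqF.
rewrite -[X in norm_le _ X]mulr1; apply: norm_leZ_ge0; first by rewrite exprn_ge0 // ltW.
by rewrite -[1]mulr1; exact: norm_leM.
Qed.

(** [K - m = (K - (m + n)) + n] is positive, so [m] and [K - m] are squares of
    commuting self-adjoint elements whose sum is [K]. *)
Lemma pos_norm_le m n K : posU m -> posU n -> norm_le (m + n) K -> norm_le m K.
Proof.
move=> pm pn mnK; apply: norm_le_eps => e e0.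
have K0 : 0 < K + e by rewrite ltr_wpDl // (norm_le_ge0 mnK).
(* The strict positivity of the bound allows [pos_subA] to be used. *)
have {e0}mnK : norm_le (m + n) (K + e) by apply: norm_le_trans mnK; rewrite lerDl ltW.
move: (K + e) K0 mnK => {}K K0 mnK.
have [p [pp [ap _] pz _]] := pos_sqrt pm.
have [|g [gg [ag _] gz _]] := @pos_sqrt (K%:A - m).
  have -> : K%:A - m = K%:A - (m + n) + n by rewrite opprD addrA subrK.
  apply: posD => //; apply: pos_subA => //.
  by case: pm pn => am _ [an _]; rewrite ustarD am an.
rewrite -pp -[X in norm_le _ X]sqrtCK expr2.
suff pK : norm_le p (sqrtC K) by exact: norm_leM.
apply: (@norm_le_sqD_comm _ g) => //; last first.
- by rewrite pp gg addrC subrK sqrtCK; apply: norm_leA; exact: ltW.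
- by rewrite sqrtC_ge0 ltW.
apply: gz; apply: commrB; last by rewrite -pp; exact: commrM.
by rewrite /GRing.comm -scalerAl -scalerAr mulr1 mul1r.
Qed.

Lemma complex_archimedean L e : 0 <= L -> 0 < e ->
  exists i : nat, L <= i.+1%:R * e.
Proof.
case: L e => [s ?] [r ?]; rewrite lecE ltcE /= => /andP[/eqP -> s0] /andP[/eqP -> r0].
exists (Num.bound (s / r)); rewrite -(rmorph_nat (@real_complex R)) -[_ +i* 0]/(s%:C).
rewrite -[X in _ * X]/(r%:C) -rmorphM lecR -ler_pdivrMr //.
apply: le_trans (ltW (archi_boundP _)) _; first by rewrite divr_ge0 // ltW.
by rewrite ler_nat.
Qed.

Lemma norm_le_archimedean m L : (forall i : nat, norm_le (i%:R *: m) L) -> m = 0.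
Proof.
move=> mL; apply/norm_le_eq0/norm_le_eps => e e0; rewrite add0r.
have [i Li] := complex_archimedean (norm_le_ge0 (mL 0%N)) e0.
have i0 : 0 < i.+1%:R :> R[i] by rewrite ltr0n.
rewrite -[m]scale1r -(mulVf (lt0r_neq0 i0)) -scalerA.
apply: norm_le_trans (norm_leZ_ge0 _ (mL _)); last by rewrite invr_ge0 ltW.
by rewrite mulrC ler_pdivrMr // mulrC.
Qed.

End Positivity.

(** * Positivity of x^* x *)
Section Kaplansky.
Context {R : realType} {E : cstarAlgType R}.
Local Notation U := (unitization E).
Implicit Types (m n z p q r y : U) (K L e t : R[i]).

Lemma ustarX r k : ustar r = r -> ustar (r ^+ k) = r ^+ k.
Proof.
move=> ar; elim: k => [|k IHk]; first by rewrite expr0 ustar1.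
by rewrite exprS ustarM ar IHk -exprSr exprS.
Qed.

Lemma ustarM_comm m n : ustar m = m -> ustar n = n -> GRing.comm m n ->
  ustar (m * n) = m * n.
Proof. by move=> am an mn; rewrite ustarM am an mn. Qed.

Lemma pos1 : posU (1 : U).
Proof. by rewrite -[1]mulr1; apply: pos_sq; exact: ustar1. Qed.

Lemma pos0 : posU (0 : U).
Proof. by rewrite -(mulr0 0); apply: pos_sq; exact: ustar0. Qed.

Lemma comm_square_add1 r z : GRing.comm z r -> GRing.comm z (1 + r ^+ 2).
Proof. by move=> zr; apply: commrD (commr1 _) _; exact: commrX. Qed.

Lemma pos_exprM r j k : ustar r = r ->
  posU (r ^+ j.*2 * (1 + r ^+ 2) ^+ k).
Proof.
move=> ar; have [g [gg [ag _] gz _]] : exists g, [/\ g * g = 1 + r ^+ 2, posU g,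
    forall z, GRing.comm z (1 + r ^+ 2) -> GRing.comm z g &
    forall D : set E, cstar_subalgebra D -> D (1 + r ^+ 2).2 -> D g.2].
  by apply: pos_sqrt; apply: posD pos1 _; rewrite expr2; exact: pos_sq.
have rg : GRing.comm r g by apply: gz; exact: comm_square_add1.
have -> : r ^+ j.*2 * (1 + r ^+ 2) ^+ k = (r ^+ j * g ^+ k) * (r ^+ j * g ^+ k).
  rewrite -expr2 exprMn_comm; last by apply: commrX; apply/commr_sym/commrX.
  by rewrite -!exprM -gg -expr2 -exprM muln2 mulnC.
apply: pos_sq; apply: ustarM_comm; try exact: ustarX.
by apply: commrX; apply/commr_sym/commrX.
Qed.

(** The binomial expansion of [r^2 (1 + r^2)^k] consists of even powers of
    [r], and [k r^4] is one of its terms. *)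
Lemma pos_growth r k : ustar r = r ->
  posU (r ^+ 2 * (1 + r ^+ 2) ^+ k - k%:R *: r ^+ 4).
Proof.
move=> ar; have posB j : posU (r ^+ 4 * (1 + r ^+ 2) ^+ j - r ^+ 4).
  elim: j => [|j IHj]; first by rewrite expr0 mulr1 subrr; exact: pos0.
  rewrite [_ ^+ j.+1]exprS mulrDl mul1r mulrDr mulrA -exprD addrAC.
  by apply: posD => //; exact: (@pos_exprM r 3).
elim: k => [|k IHk].
  by rewrite scale0r subr0; exact: (@pos_exprM r 1 0).
rewrite [_ ^+ k.+1]exprS mulrDl mul1r mulrDr mulrA -exprD mulrS scalerDl scale1r.
by rewrite [r ^+ 4 + _]addrC opprD addrACA; exact: posD.
Qed.

(** Twice this element is the sum of the squares of the self-adjoint elements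
    [y + y^*] and [i y - i y^*]. *)
Lemma pos_normal y : posU (ustar y * y + y * ustar y).
Proof.
pose h := y + ustar y; pose k := 'i%C *: (y - ustar y).
have ah : ustar h = h by rewrite ustarD ustarK addrC.
have ak : ustar k = k.
  rewrite ustarZ ustarB ustarK -opprB scalerN -scaleNr; congr (_ *: _).
  by apply/eqP; rewrite eq_complex /= oppr0 opprK !eqxx.
have -> : ustar y * y + y * ustar y = 2^-1 *: (h * h + k * k).
  have -> : k * k = - ((y - ustar y) * (y - ustar y)).
    by rewrite -scalerAr -scalerAl scalerA -['i%C * _]expr2 sqr_i scaleN1r.
  rewrite !mulrDl !mulrDr !mulNr !mulrN opprK.
  set a := y * y; set b := y * ustar y; set c := ustar y * y.
  set d := ustar y * ustar y.
  rewrite !opprD !opprK !addrA.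
  rewrite [X in _ *: X](ACl ((1*5)*(4*8)*(3*2)*(7*6))) /= !subrr !add0r.
  rewrite -mulr2n -[(c + b) *+ 2]scaler_nat scalerA.
  by rewrite mulVf ?scale1r // pnatr_eq0.
apply: posZ; first by rewrite invr_gt0.
by apply: posD; exact: pos_sq.
Qed.

(** Kaplansky's trick *)
(** By [pos_normal], [y y^*] is positive, so [b = 1 - y y^* / t] is a
    contraction for some [t].  But [b y = y (1 + q^2 / t)], so
    [y^* b^k y = - q^2 (1 + q^2 / t)^k], whose norm grows at least linearly in
    [k] unless [q = 0]. *)
Lemma ustar_mul_neg_square_eq0 y q : ustar q = q -> ustar y * y = - (q * q) -> q = 0.
Proof.
move=> aq yyq; have pv : posU (y * ustar y).
  have -> : y * ustar y = ustar y * y + y * ustar y + q * q.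
    by rewrite yyq addrAC addNr add0r.
  by apply: posD (pos_normal y) (pos_sq aq).
have [_ [t t0 vt]] := pv.
have tn0 : t != 0 by rewrite gt_eqF.
have st0 : 0 < sqrtC t by rewrite sqrtC_gt0.
pose r := (sqrtC t)^-1 *: q.
have ar : ustar r = r by rewrite ustarZ_ge0 ?aq // invr_ge0 ltW.
have tr : t *: r ^+ 2 = q * q.
  by rewrite /r exprZn scalerA exprVn sqrtCK mulfV // scale1r expr2.
pose b := 1 - t^-1 *: (y * ustar y).
have b1 : norm_le b 1.
  have -> : b = t^-1 *: (t%:A - y * ustar y).
    by rewrite scalerBr scalerA mulVf // scale1r.
  rewrite -[X in norm_le _ X](mulVf tn0); apply: norm_leZ_ge0 => //.
  by rewrite invr_ge0 ltW.
have bmuly : b * y = y * (1 + r ^+ 2).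
  rewrite mulrBl mul1r -scalerAl -mulrA yyq -tr mulrN scalerN opprK.
  by rewrite -scalerAr scalerA mulVf // scale1r mulrDr mulr1.
have bky k : b ^+ k * y = y * (1 + r ^+ 2) ^+ k.
  elim: k => [|k IHk]; first by rewrite !expr0 mul1r mulr1.
  by rewrite exprSr -mulrA bmuly mulrA IHk -mulrA -exprSr.
pose K := `|y.1 : R[i]| + `|y.2|; have yK : norm_le y K := norm_le_sum y.
have K0 := norm_le_ge0 yK.
have bound k : norm_le (r ^+ 2 * (1 + r ^+ 2) ^+ k) (t^-1 * (K * (1 * K))).
  have -> : r ^+ 2 * (1 + r ^+ 2) ^+ k = t^-1 *: - (ustar y * (b ^+ k * y)).
    rewrite bky mulrA yyq mulNr opprK -tr -scalerAl scalerA mulVf //.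
    by rewrite scale1r.
  apply: norm_leZ_ge0; first by rewrite invr_ge0 ltW.
  apply/norm_leN/norm_leM; first exact: norm_le_ustar.
  by apply: norm_leM => //; rewrite -[1](expr1n _ k); exact: norm_leX.
have r4 : r ^+ 4 = 0.
  apply: (@norm_le_archimedean _ _ _ (t^-1 * (K * (1 * K)))) => k.
  apply: (@pos_norm_le _ _ _ (r ^+ 2 * (1 + r ^+ 2) ^+ k - k%:R *: r ^+ 4)).
  - case: k => [|k]; first by rewrite scale0r; exact: pos0.
    apply: posZ; first by rewrite ltr0n.
    by have := @pos_exprM r 2 0 ar; rewrite expr0 mulr1.
  - exact: pos_growth.
  - by rewrite addrC subrK; exact: bound.
have sq0 (s : U) : ustar s = s -> s * s = 0 -> s = 0.
  by move=> s_sa ss; apply: norm_le_eq0; apply: norm_le_of_sq => //;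
    rewrite s_sa ss expr0n; exact: norm_le0.
have r2 : r ^+ 2 = 0 by apply: sq0; rewrite ?ustarX // -exprD.
by apply: sq0 => //; rewrite -tr r2 scaler0.
Qed.

Lemma ustar_mul_eq0 m : ustar m * m = 0 -> m = 0.
Proof.
move=> mm; apply: norm_le_eq0; apply: norm_le_of_sq => //.
by rewrite mm expr0n; exact: norm_le0.
Qed.

(** With [m = x^* x] and [s = |m|], the element [c = s - m] is twice the
    negative part of [m], so [m c = - s c].  For [y = x c] this gives
    [y^* y = c m c = - s c^2 = - (r c)^2] where [r] is the square root of [s].
    Hence [r c = 0], then [s c = 0] and [c^2 = 0], so that [m = s]. *)
Theorem pos_ustar_mul (x : U) : posU (ustar x * x).
Proof.
pose m := ustar x * x.
have am : ustar m = m by rewrite ustarM ustarK.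
have [s [ss ps sz _]] := pos_sqrt (pos_sq am).
have ms : GRing.comm m s by apply: sz; exact: commrM.
have [r [rr pr rz _]] := pos_sqrt ps.
have [s_sa _] := ps; have [ar _] := pr.
pose c := s - m.
have ac : ustar c = c by rewrite ustarB s_sa am.
have mr : GRing.comm m r by exact: rz.
have rc : GRing.comm r c.
  by apply: commrB; [rewrite -rr; exact: commrM | exact/commr_sym].
have mc : m * c = - (s * c).
  by rewrite !mulrBr opprB -ss ms.
have q0 : r * c = 0.
  apply: (@ustar_mul_neg_square_eq0 (x * c)); first exact: ustarM_comm.
  rewrite ustarM ac -mulrA [ustar x * _]mulrA -/m mc mulrN -rr; congr (- _).
  by rewrite -[r * r * c]mulrA (mulrA c) -rc.
have sc : s * c = 0 by rewrite -rr -mulrA q0 mulr0.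
have c0 : c = 0.
  apply: ustar_mul_eq0; rewrite ac {1}/c mulrBl mc sc oppr0 subr0 //.
by rewrite -/m; move/subr0_eq: c0 => <-.
Qed.

(** Monotonicity of the norm for the order, at the level of factors: [u^* u]
    is below [h^* h], so the norm of [u] is at most that of [h]. *)
Lemma norm_le_of_positive (u z h : U) K :
  ustar u * u + ustar z * z = ustar h * h ->
  norm_le h K -> norm_le u K.
Proof.
move=> uzh hK; apply: norm_le_of_sq; first exact: norm_le_ge0 hK.
apply: (pos_norm_le (pos_ustar_mul u) (pos_ustar_mul z)).
by rewrite uzh; exact: norm_le_sq.
Qed.

End Kaplansky.

(** * Hereditary subalgebras *)
Section Hereditary.
Context {R : realType} {E : cstarAlgType R}.
Local Notation U := (unitization E).
Implicit Types (m n z p q r : U) (K L e t : R[i]) (x y : E) (C H W : set E).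

(** With [c = a / t] and [b = 1 - c], both positive, [(k + 1) c b^k] is one
    term of the binomial expansion of [(c + b)^(k + 1) = 1], all of whose terms
    are positive.  So [a b^k] has norm at most [t / (k + 1)]. *)
Lemma approx_unit (a : U) t e : posU a -> 0 < t -> norm_le a t -> 0 < e ->
  exists k, norm_le (a * (1 - t^-1 *: a) ^+ k) e.
Proof.
move=> pa t0 a_t e0; have tn0 : t != 0 by rewrite gt_eqF.
have ti0 : 0 < t^-1 by rewrite invr_gt0.
pose c := t^-1 *: a; pose b := 1 - c; rewrite -/c -/b.
have pc : posU c by exact: posZ.
have pb : posU b.
  have -> : b = t^-1 *: (t%:A - a) by rewrite scalerBr scalerA mulVf // scale1r.
  by apply: posZ => //; apply: pos_subA => //; case: pa.
have [r [rr [ar _] rz _]] := pos_sqrt pc.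
have [g [gg [ag _] gz _]] := pos_sqrt pb.
have rg : GRing.comm r g.
  by apply: gz; apply: commrB (commr1 _) _; rewrite -rr; exact: commrM.
have pcb j i : posU (c ^+ j * b ^+ i).
  have -> : c ^+ j * b ^+ i = (r ^+ j * g ^+ i) * (r ^+ j * g ^+ i).
    rewrite -expr2 exprMn_comm; last by apply: commrX; apply/commr_sym/commrX.
    by rewrite -!exprM -rr -gg -!expr2 -!exprM mulnC (mulnC 2%N).
  apply: pos_sq; apply: ustarM_comm; try exact: ustarX.
  by apply: commrX; apply/commr_sym/commrX.
have pD i : posU (1 - b ^+ i.+1 - i.+1%:R *: (c * b ^+ i)).
  elim: i => [|i IHi].
    by rewrite expr0 expr1 mulr1 scale1r subKr subrr; exact: pos0.
  have -> : 1 - b ^+ i.+2 - i.+2%:R *: (c * b ^+ i.+1) =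
      1 - b ^+ i.+1 - i.+1%:R *: (c * b ^+ i) + i.+1%:R *: (c ^+ 2 * b ^+ i).
    have -> : c ^+ 2 * b ^+ i = c * b ^+ i - c * b ^+ i.+1.
      by rewrite [b ^+ i.+1]exprS -mulrBr mulrBl mul1r subKr mulrA expr2.
    have -> : b ^+ i.+2 = b ^+ i.+1 - c * b ^+ i.+1.
      by rewrite [LHS]exprS mulrBl mul1r.
    rewrite [i.+2%:R]mulrS scalerDl scale1r scalerBr !opprB !opprD !addrA.
    by rewrite (addrAC _ (c * _)) subrK addrK.
  by apply: posD => //; apply: posZ => //; rewrite ltr0n.
have [k tk] := complex_archimedean (ltW t0) e0.
exists k; have k0 : 0 < k.+1%:R :> R[i] by rewrite ltr0n.
have cb1 : norm_le (k.+1%:R *: (c * b ^+ k)) 1.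
  apply: (@pos_norm_le _ _ _
    (1 - b ^+ k.+1 - k.+1%:R *: (c * b ^+ k) + b ^+ k.+1)).
  - by apply: posZ => //; exact: (pcb 1%N).
  - by apply: posD => //; rewrite -[b ^+ _]mul1r; exact: (pcb 0%N).
  - by rewrite addrA [_ + (_ - _)]addrC !subrK; exact: norm_le1.
have -> : a * b ^+ k = (t / k.+1%:R) *: (k.+1%:R *: (c * b ^+ k)).
  rewrite scalerA mulfVK ?gt_eqF // -scalerAl scalerA mulfV // scale1r //.
apply: norm_le_trans (norm_leZ_ge0 _ cb1); last by rewrite divr_ge0 // ltW.
by rewrite mulr1 ler_pdivrMr // mulrC.
Qed.

Lemma closure_norm W x :
  closure W x <-> forall e : R[i], 0 < e -> exists2 w, W w & `|x - w| < e.
Proof.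
split=> [Wx e e0|Wx B /nbhs_ballP[e /= e0 eB]].
  have [|w [Ww]] := Wx (ball x e); first exact: nbhsx_ballx.
  by rewrite -ball_normE /= => xw; exists w.
have [w Ww xw] := Wx e e0; exists w; split => //; apply: eB.
by rewrite -ball_normE.
Qed.

Lemma closure_cstar_subalgebra W : W 0 ->
  (forall x y, W x -> W y -> W (x + y)) ->
  (forall (k : R[i]) x, W x -> W (k *: x)) ->
  (forall x y, W x -> W y -> W (x ** y)) ->
  (forall x, W x -> W (star x)) -> cstar_subalgebra (closure W).
Proof.
move=> W0 WD WZ WM Ws; split; first exact: subset_closure.
split; [|split; [|split; [|split]]].
- move=> x y /closure_norm Wx /closure_norm Wy; apply/closure_norm => e e0.
  have e2 : 0 < e / 2 by rewrite divr_gt0.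
  have [u Wu xu] := Wx _ e2; have [v Wv yv] := Wy _ e2.
  exists (u + v); first exact: WD.
  rewrite opprD addrACA [e]splitr.
  exact: le_lt_trans (ler_normD _ _) (ltrD xu yv).
- move=> k x /closure_norm Wx; apply/closure_norm => e e0.
  have k1 : 0 < `|k| + 1 by rewrite ltr_wpDl.
  have [u Wu xu] := Wx _ (divr_gt0 e0 k1); exists (k *: u); first exact: WZ.
  rewrite -scalerBr normrZ; move: xu; rewrite ltr_pdivlMr // mulrC.
  by apply: le_lt_trans; rewrite ler_wpM2r // lerDl.
- move=> x y /closure_norm Wx /closure_norm Wy; apply/closure_norm => e e0.
  have e2 : 0 < e / 2 by rewrite divr_gt0.
  have y1 : 0 < `|y| + 1 by rewrite ltr_wpDl.
  have [u Wu xu] := Wx _ (divr_gt0 e2 y1).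
  have u1 : 0 < `|u| + 1 by rewrite ltr_wpDl.
  have [v Wv yv] := Wy _ (divr_gt0 e2 u1); exists (u ** v); first exact: WM.
  have -> : x ** y - u ** v = (x - u) ** y + u ** (y - v).
    rewrite cmulDl cmulDr -[- u]scaleN1r -[- v]scaleN1r cmulZl cmulZr !scaleN1r.
    by rewrite addrA subrK.
  rewrite [e]splitr; apply: le_lt_trans (ler_normD _ _) _; apply: ltrD.
    apply: le_lt_trans (ler_norm_cmul _ _) _.
    move: xu; rewrite ltr_pdivlMr //; apply: le_lt_trans.
    by rewrite ler_wpM2l // lerDl.
  apply: le_lt_trans (ler_norm_cmul _ _) _.
  move: yv; rewrite ltr_pdivlMr // mulrC; apply: le_lt_trans.
  by rewrite ler_wpM2r // lerDl.
- move=> x /closure_norm Wx; apply/closure_norm => e /Wx[u Wu xu].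
  exists (star u); first exact: Ws.
  rewrite -[- star u]scaleN1r.
  have -> : star x + -1 *: star u = star (x - u).
    by rewrite -[- u]scaleN1r starD starZ rmorphN1.
  by rewrite norm_star.
exact: closed_closure.
Qed.

Lemma positive_inU C a : cstar_subalgebra C -> positive C a ->
  [/\ C a, star a = a & posU (inU a)].
Proof.
move=> [_ [_ [_ [CM [Cs _]]]]] [x Cx <-]; split.
- by apply: (CM) => //; exact: Cs.
- by rewrite starM starK.
- by rewrite inUM -ustar_inU; exact: pos_ustar_mul.
Qed.

Lemma unitization_mul C m n : cstar_subalgebra C ->
  C m.2 -> C n.2 -> C (m * n).2.
Proof.
move=> [_ [CD [CZ [CM _]]]] Cm Cn /=; apply: (CD); last exact: CM.
by apply: (CD); exact: CZ.
Qed.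

(** With [f = (1 - a / t)^k], monotonicity of the norm bounds [u f] by [h f],
    which is small since [h] is close to some [a k a].  As [1 - f] is both a
    left and a right multiple of [a], the element [(1 - f) x (1 - f)] has the
    form [a k' a], and it differs from [x = u^* u] by
    [u^* (u f) + (u f)^* u (1 - f)]. *)
Lemma hereditary_hereditary_gen C a : cstar_subalgebra C -> positive C a ->
  hereditary C (hereditary_gen C a).
Proof.
move=> sC pa; have [Ca aa pUa] := positive_inU sC pa.
have [C0 [CD [CZ [CM [Cs cC]]]]] := sC.
have CN x : C x -> C (- x) by move=> Cx; rewrite -scaleN1r; exact: CZ.
split.
- apply: closure_cstar_subalgebra.
  + by exists 0 => //; rewrite mulc0 mul0c.
  + move=> _ _ [x Cx <-] [y Cy <-]; exists (x + y); first exact: CD.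
    by rewrite cmulDr cmulDl.
  + move=> k _ [x Cx <-]; exists (k *: x); first exact: CZ.
    by rewrite cmulZr cmulZl.
  + move=> _ _ [x Cx <-] [y Cy <-]; exists (x ** (a ** a) ** y).
      by do !apply: (CM).
    by rewrite !cmulA.
  + move=> _ [x Cx <-]; exists (star x); first exact: Cs.
    by rewrite !starM aa cmulA.
- have aCa : [set a ** x ** a | x in C] `<=` C.
    by move=> _ [x Cx <-]; do !apply: (CM).
  by move=> x /(closure_subset aCa); exact: cC.
move=> x y [u Cu xu] [h Hh yh] [z Cz zyx]; apply/closure_norm => e e0.
pose t := `|a| + 1; have t0 : 0 < t by rewrite ltr_wpDl.
have tn0 : t != 0 by rewrite gt_eqF.
have a_t : norm_le (inU a) t by apply: norm_le_trans (norm_le_inU a); rewrite lerDl.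
pose b := 1 - t^-1 *: inU a.
(* The final error is at most [|u| (2 d) + (2 d) |u| 2], and [h f] is bounded
   by [2 d]: one [d] for the distance from [h] to [a C a], one for [a f]. *)
have [d d0 de] : exists2 d : R[i], 0 < d & `|u| * (d + d) * 3 < e.
  have u1 : 0 < `|u| + 1 by rewrite ltr_wpDl.
  exists (e / (6 * (`|u| + 1))); first by rewrite divr_gt0 // mulr_gt0.
  have -> : `|u| * (e / (6 * (`|u| + 1)) + e / (6 * (`|u| + 1))) * 3 =
            e * (`|u| / (`|u| + 1)) by field; rewrite gt_eqF.
  by rewrite gtr_pMr // ltr_pdivrMr // mul1r ltrDl.
move: (Hh) => /closure_norm /(_ d d0)[_ [k Ck <-] hk].
have ak1 : 0 < `|a ** k| + 1 by rewrite ltr_wpDl.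
have [i abi] := approx_unit pUa t0 a_t (divr_gt0 d0 ak1).
rewrite -/b in abi; pose f := b ^+ i.
have ab : ustar b = b.
  rewrite ustarB ustar1 ustarZ_ge0 ?invr_ge0 ?(ltW t0) //.
  by case: pUa => ->.
have af : ustar f = f by exact: ustarX.
have b1 : norm_le b 1.
  have -> : b = t^-1 *: (t%:A - inU a) by rewrite scalerBr scalerA mulVf // scale1r.
  rewrite -[X in norm_le _ X](mulVf tn0); apply: norm_leZ_ge0.
    by rewrite invr_ge0 ltW.
  apply: (@pos_norm_le _ _ _ (inU a)) => //; last by rewrite subrK; exact/norm_leA/ltW.
  by apply: pos_subA => //; case: pUa.
have f1 : norm_le f 1 by rewrite -[1](expr1n _ i); exact: norm_leX.
have hf : norm_le (inU h * f) (d + d).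
  have -> : inU h * f = inU (h - a ** k ** a) * f + inU (a ** k) * (inU a * f).
    by rewrite mulrA -inUM -mulrDl -inUD subrK.
  apply: norm_leD.
    rewrite -[X in norm_le _ X]mulr1; apply: norm_leM => //.
    by apply: norm_le_trans (norm_le_inU _); exact: ltW.
  apply: norm_le_trans (norm_leM (norm_le_inU _) abi).
  rewrite mulrCA ler_piMr ?ltW // ?ltr_pdivrMr // ?mul1r ?ltrDl //.
have uf : norm_le (inU u * f) (d + d).
  apply: (@norm_le_of_positive _ _ _ (inU z * f) _ _ _ hf).
  rewrite !ustarM af -!mulrA ![ustar (inU _) * (inU _ * _)]mulrA.
  rewrite !ustar_inU -!inUM -mulrDr -mulrDl -inUD xu zyx yh.
  by rewrite addrC subrK.
have [K [CK aK Ka]] : exists K : U,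
    [/\ C K.2, 1 - f = inU a * K & 1 - f = K * inU a].
  have Cb : C b.2 by rewrite /= add0r; apply: (CN); exact: CZ.
  have C1 : C (1 : U).2 by exact: C0.
  rewrite /f; elim: (i) => [|j [K [CK aK Ka]]].
    by exists 0; rewrite expr0 subrr mulr0 mul0r.
  have Cbj : C (b ^+ j).2.
    elim: (j) => [|l IHl]; first by rewrite expr0.
    by rewrite exprS; exact: unitization_mul.
  have bE : 1 - b = t^-1 *: inU a by rewrite subKr.
  exists (K + t^-1 *: b ^+ j); split.
  - by apply: (CD) => //; exact: CZ.
  - rewrite mulrDr -aK -scalerAr scalerAl -bE exprS [(1 - b) * _]mulrBl mul1r.
    by rewrite addrA subrK.
  - rewrite mulrDl -Ka -scalerAl scalerAr -bE exprSr [_ * (1 - b)]mulrBr mulr1.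
    by rewrite addrA subrK.
pose k' := (K * inU x * K).2.
have k'E : inU k' = K * inU x * K.
  by rewrite [RHS]surjective_pairing; congr pair; rewrite /= mulr0 mul0r.
have Cx : C x by rewrite -xu; apply: (CM) => //; exact: Cs.
exists (a ** k' ** a).
  exists k' => //; apply: unitization_mul => //; exact: unitization_mul.
apply: le_lt_trans de; apply: norm_le_inU_inv.
have -> : inU (x - a ** k' ** a) =
    inU (star u) * (inU u * f) + ustar (inU u * f) * inU u * (1 - f).
  rewrite inUB.
  have -> : inU (a ** k' ** a) = (1 - f) * inU x * (1 - f).
    by rewrite {1}aK Ka !inUM k'E !mulrA.
  rewrite ustarM af ustar_inU mulrA -inUM xu -[f * _ * inU u]mulrA -inUM xu.
  rewrite [(1 - f) * _]mulrBl mul1r [in LHS]mulrBl opprB addrCA.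
  by rewrite [inU x * (1 - f)]mulrBr mulr1 subKr addrC.
have -> : `|u| * (d + d) * 3 = `|star u| * (d + d) + (d + d) * `|u| * (1 + 1).
  by rewrite norm_star; ring.
apply: norm_leD; first by apply: norm_leM => //; exact: norm_le_inU.
apply: norm_leM; last by apply: norm_leB => //; exact: norm_le1.
by apply: norm_leM; [exact: norm_le_ustar | exact: norm_le_inU].
Qed.

(** For self-adjoint [c] of norm at most [K], write [K + c = w^2] and
    [K - c = v^2]; then [(w a)^* (w a) + (v a)^* (v a) = 2 K a a], so that
    [a (K + c) a] is below an element of [H].  Any other [c] is a combination
    of two self-adjoint ones. *)
Lemma hereditary_gen_sub C H a : cstar_subalgebra C -> hereditary C H ->
  positive H a -> hereditary_gen C a `<=` H.
Proof.
move=> sC [sH HC Hher] pa.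
have [C0 [CD [CZ [CM [Cs cC]]]]] := sC.
have [H0 [HD [HZ [HM [Hs cH]]]]] := sH.
have [Ha aa pUa] := positive_inU sH pa; have Ca := HC _ Ha.
have Haca_sa c : C c -> star c = c -> H (a ** c ** a).
  move=> Cc cc; pose K := `|c| + 1; have K0 : 0 < K by rewrite ltr_wpDl.
  have cK : norm_le (inU c) K by apply: norm_le_trans (norm_le_inU c); rewrite lerDl.
  have ac : ustar (inU c) = inU c by rewrite ustar_inU cc.
  have pl : posU (K%:A + inU c).
    rewrite -[inU c]opprK; apply: pos_subA => //; last exact: norm_leN.
    by rewrite ustarN ac.
  have pr : posU (K%:A - inU c) by exact: pos_subA.
  have Cl : C (K%:A + inU c).2 by rewrite /= scaler0 add0r.
  have Cr : C (K%:A - inU c).2 by rewrite /= scaler0 add0r -scaleN1r; exact: CZ.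
  have [w [ww [aw _] _ /(_ _ sC Cl) Cw]] := pos_sqrt pl.
  have [v [vv [av _] _ /(_ _ sC Cr) Cv]] := pos_sqrt pr.
  have Cact m : C m.2 -> C (act m a).
    by move=> Cm; apply: (CD); [exact: CZ | exact: CM].
  have actE m : ustar m = m -> 
      inU (star (act m a) ** act m a) = inU a * (m * m) * inU a.
    move=> am; rewrite inUM -ustar_inU -mulU_inU ustarM am ustar_inU aa.
    by rewrite !mulrA.
  have lE : star (act w a) ** act w a = K *: (a ** a) + a ** c ** a.
    suff : inU (star (act w a) ** act w a) = inU (K *: (a ** a) + a ** c ** a).
      by case.
    rewrite actE // ww inUD inUZ !inUM mulrDr mulrDl -scalerAr mulr1.
    by rewrite -scalerAl.
  have rE : star (act v a) ** act v a = K *: (a ** a) - a ** c ** a.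
    suff : inU (star (act v a) ** act v a) = inU (K *: (a ** a) - a ** c ** a).
      by case.
    rewrite actE // vv inUB inUZ !inUM mulrBr mulrBl -scalerAr mulr1.
    by rewrite -scalerAl.
  have Haa : H (a ** a) by exact: HM.
  have -> : a ** c ** a = star (act w a) ** act w a + (- K) *: (a ** a).
    by rewrite lE scaleNr addrAC subrr add0r.
  apply: (HD); last exact: HZ.
  apply: (Hher _ ((K + K) *: (a ** a))).
  - by exists (act w a) => //; apply: (Cact).
  - exists (sqrtC (K + K) *: a); first exact: HZ.
    have KK0 : 0 <= K + K by apply: addr_ge0; exact: ltW.
    rewrite starZ geC0_conj ?sqrtC_ge0 //.
    by rewrite cmulZl cmulZr scalerA -expr2 sqrtCK aa.
  - rewrite /cstar_le; exists (act v a); first by apply: (Cact).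
    by rewrite rE lE [(K + K) *: _]scalerDl opprD addrA addrK.
have Haca : [set a ** x ** a | x in C] `<=` H.
  move=> _ [c Cc <-].
  have CN x : C x -> C (- x) by move=> Cx; rewrite -scaleN1r; exact: CZ.
  have -> : c = 2^-1 *: ((c + star c) + - 'i%C *: ('i%C *: (c - star c))).
    rewrite scalerA mulNr -['i%C * _]expr2 sqr_i opprK scale1r addrACA subrr addr0.
    by rewrite -mulr2n -[c *+ 2]scaler_nat scalerA mulVf ?scale1r // pnatr_eq0.
  rewrite cmulZr cmulZl; apply: (HZ); rewrite cmulDr cmulDl; apply: (HD).
    apply: Haca_sa; first by apply: (CD) => //; exact: Cs.
    by rewrite starD starK addrC.
  rewrite cmulZr cmulZl; apply: (HZ); apply: Haca_sa.
    by apply: (CZ); apply: (CD) => //; apply: (CN); exact: Cs.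
  have cE : star (c - star c) = - (c - star c).
    by rewrite -[in LHS]scaleN1r starD starZ starK rmorphN1 scaleN1r opprB addrC.
  rewrite starZ cE scalerN -scaleNr; congr (_ *: _).
  by apply/eqP; rewrite eq_complex /= oppr0 opprK !eqxx.
by move=> x /(closure_subset Haca); exact: cH.
Qed.

Lemma star_mul_neq0 x : x != 0 -> star x ** x != 0.
Proof.
apply: contra => /eqP xx; have := norm_star_cmul x.
by rewrite xx normr0 => /esym/eqP; rewrite expf_eq0 /= normr_eq0.
Qed.

End Hereditary.

Theorem theoremB (R : realType) (E : cstarAlgType R) :
  (forall A B : set E,
     cstar_subalgebra A -> cstar_subalgebra B -> A `<=` B ->
     ((exists C : set E,
         [/\ cstar_subalgebra C, A `<=` C, C `<=` B & property_SP C]) ->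
      SP_inclusion A B) /\
     (property_SP A \/ property_SP B -> SP_inclusion A B)) /\
  (forall C : set E,
     cstar_subalgebra C -> (property_SP C <-> SP_inclusion C C)).
Proof.
have mid (A B C : set E) : cstar_subalgebra A -> cstar_subalgebra C ->
    A `<=` C -> C `<=` B -> property_SP C -> SP_inclusion A B.
  move=> sA sC AC CB spC a pa a0; have [Aa aa _] := positive_inU sA pa.
  have pCa : positive C a by case: pa => x Ax <-; exists x => //; exact: AC.
  have aaa0 : a ** a ** a != 0.
    apply/eqP => aaa; move/eqP: (star_mul_neq0 (star_mul_neq0 a0)); apply.
    by rewrite starM !aa cmulA aaa mul0c.
  have [|p [Hp pp p0]] := spC _ (hereditary_hereditary_gen sC pCa).
    exists (a ** a ** a) => //; apply: subset_closure.
    by exists a => //; exact: AC.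
  exists p; split => //; apply: closure_subset Hp => _ [x Cx <-].
  by exists x => //; exact: CB.
split=> [A B sA sB AB|C sC].
  split=> [[C [sC AC CB spC]]|[spA|spB]]; first exact: mid spC.
    exact: mid spA.
  exact: mid spB.
split=> [spC|spC H hH [x Hx x0]]; first exact: mid spC.
have [sH HC _] := hH.
have pH : positive H (star x ** x) by exists x.
have [|p [Hp pp p0]] := spC (star x ** x) _ (star_mul_neq0 x0).
  by exists x => //; exact: HC.
by exists p; split => //; exact: hereditary_gen_sub Hp.
Qed.
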